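(* Let $H_0,H_1$ be Hilbert spaces and let $A_c\colon \operatorname{dom}(A_c)\subseteq H_0\to H_1$ and $B_c\colon\operatorname{dom}(B_c)\subseteq H_1\to H_0$ be densely defined linear operators with $A_c\subseteq -B_c^{\ast}$. Let $A_0=\overline{A_c}$, $B_0=\overline{B_c}$, $A=-B_c^{\ast}$, $B=-A_c^{\ast}$, and let $A^{\#}\subseteq A$ and $B^{\#}\subseteq B$ be the restrictions with domains $\operatorname{dom}(A^{\#})=\{x\in\operatorname{dom}(A) : Ax\in\overline{\operatorname{ran}}(A_0)\}$ and $\operatorname{dom}(B^{\#})=\{y\in\operatorname{dom}(B) : By\in\overline{\operatorname{ran}}(B_0)\}$. Then $$-\left(B^{\#}\right)^{\ast}\subseteq A^{\#}.$$ Moreover, the following statements are equivalent: (i) $-(B^{\#})^{\ast}=A^{\#}$; (ii) $\ker(A)+\operatorname{dom}(A_0)$ is a core for $A^{\#}$; (iii) $1\notin P\sigma(B^{\#}A^{\#})$, i.e. $1$ is not an eigenvalue of $B^{\#}A^{\#}$. Moreover, the statements (i)-(iii) hold if $\operatorname{ran}(A^{\#})$ is closed.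
   Context: For (unbounded) linear operators, $S\subseteq T$ means that $T$ extends $S$. The adjoint of a densely defined operator $T$ is $T^{\ast}$, and $-T^\ast$ means $-(T^\ast)$. From $A_c\subseteq -B_c^\ast$ one gets $B_c\subseteq -A_c^\ast$, so $A_c$ and $B_c$ are closable and $\overline{A_c},\overline{B_c}$ denote their closures; then $A=-B_0^\ast$, $B=-A_0^\ast$, $A_0\subseteq A^{\#}\subseteq A$ and $B_0\subseteq B^{\#}\subseteq B$. $\overline{\operatorname{ran}}(T)$ denotes the closure of the range of $T$. A subspace $D\subseteq\operatorname{dom}(T)$ is a core for a closed operator $T$ if $\overline{T|_D}=T$, equivalently if $D$ is dense in $\operatorname{dom}(T)$ with respect to the graph norm. $P\sigma$ denotes the point spectrum (set of eigenvalues), and $B^{\#}A^{\#}$ has domain $\{x\in\operatorname{dom}(A^{\#}) : A^{\#}x\in\operatorname{dom}(B^{\#})\}$. *)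

(* Defs.v *)
From HB Require Import structures.
From mathcomp Require Import all_boot all_order all_algebra sesquilinear.
From mathcomp Require Import boolp classical_sets reals topology normedtype.
From mathcomp Require Import complex.

Set Implicit Arguments.
Unset Strict Implicit.
Unset Printing Implicit Defensive.

Import Order.TTheory GRing.Theory Num.Theory.
Import numFieldNormedType.Exports.

Local Open Scope classical_set_scope.
Local Open Scope ring_scope.

(* The scalar field K is either the field R of real numbers, with the identity
   as conjugation, or the field R[i] of complex numbers, with complex
   conjugation. *)
Variant real_or_complex (R : realType) :
    forall K : numFieldType, (K -> K) -> Prop :=
| RealScalars : real_or_complex R (K := R) idfun
| ComplexScalars : real_or_complex R (K := R[i]) (@Num.conj R[i]).

(* The inner product is linear in its first argument and conjugate-linear in
   its second one. *)
Record hilbertSpace (K : numFieldType) (conj : K -> K) := HilbertSpace {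
  hilbert_sort :> completeNormedModType K ;
  inner : {dot hilbert_sort for conj} ;
  inner_norm : forall x : hilbert_sort, inner x x = `|x| ^+ 2
}.

Section Subspaces.
Context {K : numFieldType} {V : lmodType K}.

Definition subspace (D : set V) : Prop :=
  D 0 /\ forall (a : K) u v, D u -> D v -> D (a *: u + v).

Definition sumset (D E : set V) : set V :=
  [set w | exists u v, [/\ D u, E v & w = u + v]].

End Subspaces.

(* A partially defined operator is represented by its graph: T (x, y) means that
   x belongs to the domain of T and that T x = y. Inclusion of graphs is then
   extension of operators, and equality of graphs is equality of operators,
   domains included. *)
Section Graphs.
Context {K : numFieldType} {conj : K -> K}.
Implicit Types U V W : hilbertSpace conj.

Definition linear_operator U V (T : set (U * V)) : Prop :=
  [/\ T (0, 0),
      forall (a : K) x y x' y', T (x, y) -> T (x', y') ->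
        T (a *: x + x', a *: y + y')
    & forall x y y', T (x, y) -> T (x, y') -> y = y'].

Definition dom U V (T : set (U * V)) : set U := [set x | exists y, T (x, y)].

Definition ran U V (T : set (U * V)) : set V := [set y | exists x, T (x, y)].

Definition ker U V (T : set (U * V)) : set U := [set x | T (x, 0)].

Definition densely_defined U V (T : set (U * V)) : Prop := dense (dom T).

Definition opp_op U V (T : set (U * V)) : set (U * V) :=
  [set p | T (p.1, - p.2)].

Definition restr_op U V (T : set (U * V)) (D : set U) : set (U * V) :=
  [set p | T p /\ D p.1].

Definition comp_op U V W (S : set (V * W)) (T : set (U * V)) : set (U * W) :=
  [set p | exists2 y, T (p.1, y) & S (y, p.2)].

(* (y, x') is in the graph of the adjoint iff <T x, y> = <x, x'> for every x in
   the domain of T; x' is determined by y when T is densely defined. *)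
Definition adjoint U V (T : set (U * V)) : set (V * U) :=
  [set p | forall x z, T (x, z) -> inner V z p.1 = inner U x p.2].

(* The graph of the closure of a closable operator is the closure of its
   graph. *)
Definition closure_op U V (T : set (U * V)) : set (U * V) := closure T.

Definition core U V (T : set (U * V)) (D : set U) : Prop :=
  [/\ subspace D, D `<=` dom T & closure_op (restr_op T D) = T].

Definition eigenvalue_op U (T : set (U * U)) (l : K) : Prop :=
  exists2 x, x != 0 & T (x, l *: x).

(* The restriction of A to the x in its domain with A x in the closure of the
   range of A0. *)
Definition sharp U V (A A0 : set (U * V)) : set (U * V) :=
  restr_op A [set x | exists2 y, A (x, y) & closure (ran A0) y].

End Graphs.

(* Main.v *)
From HB Require Import structures.
Require Import Defs.
From mathcomp Require Import all_boot all_order all_algebra sesquilinear.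
From mathcomp Require Import boolp classical_sets reals topology normedtype.
From mathcomp Require Import prodnormedzmodule.
From mathcomp Require Import complex ring.

Set Implicit Arguments.
Unset Strict Implicit.
Unset Printing Implicit Defensive.

Import Order.TTheory GRing.Theory Num.Theory.
Import numFieldNormedType.Exports.

Local Open Scope classical_set_scope.
Local Open Scope ring_scope.

(* View operators as subspaces of H0 x H1, exchanging the coordinates for those
   from H1 to H0. Then - T^* is the orthogonal complement of T. Since
   ran(A0)^perp = ker B and ran(B0)^perp = ker A, one gets
   - (B#)^* = closure (A0 + ker A x 0), which lies in A#. This gives (i) <-> (ii).
   The orthogonal complement of - (B#)^* in A# is the intersection of A# and B#,
   i.e. the set of (x, A# x) with B# A# x = x, which gives (i) <-> (iii).

   If ran A# is closed, it equals N = closure (ran A0). Let B# A# x = x, y = A# x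
   and write x as a limit of B0 w. The projections of the w on N are pointwise
   bounded, as functionals, on ran A# = N, hence bounded by uniform boundedness, so
   that |<s, x>| <= M |A# s| for every s in dom A#. Taking s = x' - x with
   x' in dom A0 and A0 x' close to y, and using <x', x> = - <A0 x', y>, one
   finds |x|^2 + |y|^2 = 0. *)

(** * Order properties shared by the real and the complex scalars *)

(** Besides the identity [a * theta a = |a| ^+ 2], this property and the next are all that the
    argument asks of the scalars, so the real and complex cases are treated together. *)
Definition nat_unbounded (K : numFieldType) : Prop :=
  forall x : K, exists n : nat, `|x| < n%:R.

(** Restricted to sets of nonnegative elements, since those are real even in [R[i]], where the order
    is only partial. *)
Definition has_infima (K : numFieldType) : Prop :=
  forall E : set K, E !=set0 -> (forall x, E x -> 0 <= x) ->
  exists d : K, (forall x, E x -> d <= x) /\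
    (forall e, 0 < e -> exists2 x, E x & x < d + e).

Lemma real_nat_unbounded (R : realType) : nat_unbounded R.
Proof. by move=> x; exists (Num.truncn `|x|).+1; exact: truncnS_gt. Qed.

Lemma real_has_infima (R : realType) : has_infima R.
Proof.
move=> E E0 E_ge0.
have Elb : has_lbound E by exists 0 => x; exact: E_ge0.
exists (inf E); split=> [x Ex|e e_gt0]; first exact: ge_inf.
by have [x] := inf_adherent e_gt0 (conj E0 Elb); exists x.
Qed.

Lemma complex_nat_unbounded (R : realType) : nat_unbounded R[i].
Proof.
move=> x; have /complex_realP[r xr] := normr_real x.
have [n rn] := real_nat_unbounded r; exists n.
rewrite xr -(rmorph_nat (real_complex R)) ltcR.
by rewrite (le_lt_trans (ler_norm r)).
Qed.

Lemma complex_has_infima (R : realType) : has_infima R[i].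
Proof.
move=> E [x0 Ex0] E_ge0.
have Ereal x : E x -> x = (complex.Re x)%:C%C.
  by move=> Ex; rewrite RRe_real// ger0_real// E_ge0.
have [||d [d_le d_adh]] := @real_has_infima R [set r | E r%:C%C].
- by exists (complex.Re x0) => /=; rewrite -Ereal.
- by move=> r /E_ge0; rewrite lecR.
exists d%:C%C; split=> [x Ex|e e_gt0].
  by rewrite (Ereal x Ex) lecR d_le//= -Ereal.
have er : e = (complex.Re e)%:C%C by rewrite RRe_real// gtr0_real.
have [|r Er rlt] := d_adh (complex.Re e); first by rewrite -ltcR -er.
by exists r%:C%C => //; rewrite er -rmorphD ltcR.
Qed.

(** * Closures, subspaces and completeness in normed modules *)

Lemma ler_norm_of_sqr (K : numFieldType) (a b : K) :
  0 <= b -> `|a| ^+ 2 <= b ^+ 2 -> `|a| <= b.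
Proof. by move=> b_ge0; rewrite ler_pXn2r// nnegrE. Qed.

Lemma normed_closureP (K : numFieldType) (V : normedModType K) (A : set V) u :
  closure A u <-> forall e, 0 < e -> exists2 v, A v & `|u - v| < e.
Proof.
split=> [Au e e_gt0|Au B /nbhs_ballP[e /= e_gt0 eB]].
  by have [v [Av]] := Au _ (nbhsx_ballx u e e_gt0); rewrite -ball_normE; exists v.
by have [v Av uv] := Au e e_gt0; exists v; split=> //; apply: eB; rewrite -ball_normE.
Qed.

Lemma closure_subspace (K : numFieldType) (V : normedModType K) (A : set V) :
  Defs.subspace A -> Defs.subspace (closure A).
Proof.
move=> [A0 AP]; split=> [|a u v /normed_closureP Au /normed_closureP Av].
  exact: subset_closure.
apply/normed_closureP => e e_gt0.
(* Dividing by [|a| + 1] instead of [|a|] covers [a = 0]. *)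
have a1_gt0 : 0 < `|a| + 1 by rewrite ltr_wpDl.
have [|u' Au' uu'] := Au (e / 2 / (`|a| + 1)); first by rewrite !divr_gt0.
have [|v' Av' vv'] := Av (e / 2); first by rewrite divr_gt0.
exists (a *: u' + v'); first exact: AP.
rewrite opprD addrACA -scalerBr (splitr e).
rewrite (le_lt_trans (ler_normD _ _))// ler_ltD// normrZ.
rewrite (le_trans (ler_wpM2l _ (ltW uu')))//.
rewrite mulrCA ger_pMr ?divr_gt0// ler_pdivrMr// mul1r.
by rewrite lerDl.
Qed.

(** A property rather than a structure, so that it can be transferred to products. *)
Definition complete_space (K : numFieldType) (V : normedModType K) : Prop :=
  forall F : set_system V, ProperFilter F -> cauchy_ex F -> exists l : V, F --> l.

Lemma complete_normedModType (K : numFieldType) (V : completeNormedModType K) :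
  complete_space V.
Proof. by move=> F FF /cauchy_exP /cauchy_cvg /cvg_ex. Qed.

Lemma complete_prod (K : numFieldType) (U V : normedModType K) :
  complete_space U -> complete_space V -> complete_space (U * V)%type.
Proof.
move=> Uc Vc F FF Fc.
have [|u Fu] := Uc (fst @ F).
  move=> e /Fc[x Fx]; exists x.1.
  by apply: (@filterS _ F _ (ball x e) (fst @^-1` ball x.1 e)) Fx => y [].
have [|v Fv] := Vc (snd @ F).
  move=> e /Fc[x Fx]; exists x.2.
  by apply: (@filterS _ F _ (ball x e) (snd @^-1` ball x.2 e)) Fx => y [].
exists (u, v) => A [[B C] /= [uB vC] BCA].
have FB : F (fst @^-1` B) := Fu _ uB; have FC : F (snd @^-1` C) := Fv _ vC.
apply: filterS (filterI FB FC) => -[x y] [Bx Cy]; exact: BCA.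
Qed.

(** * Dot forms: Cauchy-Schwarz, orthogonal complements, projection theorem *)

Section DotForms.
Context {K : numFieldType} {theta : involutive_rmorphism K}.
Hypothesis theta_norm : forall a : K, a * theta a = `|a| ^+ 2.

Section Orthogonality.
Context {V : lmodType K} (phi : {dot V for theta}).
Implicit Types (u v w : V) (D : set V).

Lemma dotC u v : phi u v = theta (phi v u).
Proof. by rewrite (hermC phi) expr0 mul1r. Qed.

Lemma dot_eq0C u v : phi u v = 0 -> phi v u = 0.
Proof. by rewrite dotC => /(canRL (rmorphK theta)); rewrite rmorph0. Qed.

Lemma dot_ge0 u : 0 <= phi u u.
Proof.
have [->|/neq0_dnorm_gt0/ltW//] := eqVneq u 0.
by rewrite linear0l.
Qed.

Lemma dot_eq0 u : phi u u = 0 -> u = 0.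
Proof.
by move=> uu; apply/eqP/negPn/negP => /(neq0_dnorm_gt0 (s := phi)); rewrite uu ltxx.
Qed.

(** Pythagoras for the component of [u] orthogonal to [w]. It serves both Cauchy-Schwarz and the
    variational estimate in the projection theorem. *)
Lemma dot_sub_proj u w : w != 0 ->
  let v := u - (phi u w / phi w w) *: w in
  phi v v = phi u u - `|phi u w| ^+ 2 / phi w w.
Proof.
move=> /(neq0_dnorm_gt0 (s := phi)) w_gt0 /=.
have wwV : theta (phi w w)^-1 = (phi w w)^-1 by rewrite fmorphV/= -dotC.
rewrite (hnormB phi) expr0 mul1r linearZr_LR /= !linearZl_LR /= linearZr_LR /=.
rewrite !rmorphM /= !wwV !rmorphK -theta_norm.
by field; rewrite gt_eqF.
Qed.

Lemma dot_CauchySchwarz u w : `|phi u w| ^+ 2 <= phi u u * phi w w.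
Proof.
have [->|w_neq0] := eqVneq w 0.
  by rewrite !linear0r normr0 expr0n mulr0.
have := dot_ge0 (u - (phi u w / phi w w) *: w).
rewrite dot_sub_proj// subr_ge0 ler_pdivrMr//.
exact: neq0_dnorm_gt0.
Qed.

Definition perp D : set V := [set v | forall u, D u -> phi u v = 0].

Lemma perp_subspace D : Defs.subspace (perp D).
Proof.
split=> [u _|a u v Du Dv w Dw]; first by rewrite linear0r.
by rewrite linearPr /= Du// Dv// mulr0 addr0.
Qed.

Lemma sub_perp2 D : D `<=` perp (perp D).
Proof. by move=> u Du v Dv; apply/dot_eq0C/Dv. Qed.

End Orthogonality.

(* phi is only assumed to induce a norm equivalent to that of V because the
   norm of a product is the maximum of the norms of the coordinates. *)
Section Completeness.
Hypothesis K_inf : has_infima K.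
Context {V : normedModType K} (phi : {dot V for theta}) (c : K).
Hypothesis V_complete : complete_space V.
Hypothesis c_ge0 : 0 <= c.
Hypothesis phi_ge : forall u, `|u| ^+ 2 <= phi u u.
Hypothesis phi_le : forall u, phi u u <= c * `|u| ^+ 2.
Implicit Types (u v w : V) (C D : set V).

Lemma dot_bounded w : exists2 k, 0 < k & forall u, `|phi u w| <= k * `|u|.
Proof.
have w_ge0 := dot_ge0 phi w.
(* Cauchy-Schwarz bounds the functional by the square root of [c * phi w w]. Since [s + 1] dominates
   the square root of [s], this positive constant avoids taking roots. *)
exists (c * phi w w + 1) => [|u].
  by rewrite ltr_wpDl// mulr_ge0.
have k_ge0 : 0 <= c * phi w w by rewrite mulr_ge0.
apply: ler_norm_of_sqr; first by rewrite mulr_ge0// addr_ge0.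
rewrite (le_trans (dot_CauchySchwarz phi u w))// exprMn.
rewrite (le_trans (ler_wpM2r w_ge0 (phi_le u)))// mulrAC ler_wpM2r ?exprn_ge0//.
set k := c * _ in k_ge0 *.
rewrite -subr_ge0 (_ : _ - _ = k ^+ 2 + k + 1); last by ring.
by rewrite !addr_ge0 ?exprn_ge0.
Qed.

Lemma closed_perp D : closed (perp phi D).
Proof.
move=> v /normed_closureP Dv u Du.
have [k k_gt0 phik] := dot_bounded u.
apply: dot_eq0C; apply/eqP; rewrite -normr_le0; apply/ler_addgt0Pr => e e_gt0.
have [|v' Dv' vv'] := Dv (e / k); first by rewrite divr_gt0.
rewrite add0r -[v](subrK v') linearDl /= (dot_eq0C (Dv' u Du)) addr0.
by rewrite (le_trans (phik _))// mulrC -ler_pdivlMr// ltW.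
Qed.

Lemma parallelogram u v :
  phi (u - v) (u - v) = phi u u *+ 2 + phi v v *+ 2 - phi (u + v) (u + v).
Proof. by rewrite (hnormB phi) (hnormD phi) /= !mulr2n; ring. Qed.

(** The points of [C] that nearly minimise the distance to [x] form a Cauchy filter by the
    parallelogram identity; its limit is the projection. *)
Lemma projection C x : Defs.subspace C -> closed C ->
  exists2 p, C p & perp phi C (x - p).
Proof.
move=> [C0 CP] Cclosed.
have CD v w : C v -> C w -> C (v + w) by move=> Cv Cw; rewrite -(scale1r v); exact: CP.
have CZ a v : C v -> C (a *: v) by move=> Cv; rewrite -(addr0 (_ *: _)); exact: CP.
pose q u := phi u u.
have [||d [d_le d_adh]] := K_inf (E := [set q (x - v) | v in C]).
- by exists (q (x - 0)), 0.
- by move=> _ [v _ <-]; exact: dot_ge0.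
have {}d_le v : C v -> d <= q (x - v) by move=> Cv; apply: d_le; exists v.
pose B e : set V := [set v | C v /\ q (x - v) < d + e].
have B_neq0 e : 0 < e -> B e !=set0.
  by move=> /d_adh[_ [v Cv <-] ve]; exists v.
have B_diam e v w : B e v -> B e w -> q (v - w) < 4 * e.
  move=> [Cv ve] [Cw we].
  rewrite /q -(_ : (x - w) - (x - v) = v - w); last first.
    by rewrite opprB addrC addrA subrK.
  rewrite parallelogram.
  (* The midpoint of [v] and [w] lies in [C], so its squared distance to [x] is at least [d]. *)
  have -> : (x - w) + (x - v) = 2 *: (x - 2^-1 *: (v + w)).
    rewrite scalerBr scalerA mulfV ?pnatr_eq0// scale1r scaler_nat mulr2n.
    by rewrite [v + w]addrC opprD addrACA.
  have := d_le _ (CZ 2^-1 _ (CD _ _ Cv Cw)).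
  rewrite linearZr_LR linearZl_LR /= rmorph_nat.
  rewrite /q in ve we * => dm.
  rewrite -subr_gt0 in ve; rewrite -subr_gt0 in we; rewrite -subr_ge0 in dm.
  rewrite -subr_gt0; move: ve we dm.
  move: (phi _ _) (phi _ _) (phi _ _) => m a b b_lt a_lt m_ge.
  rewrite (_ : _ - _ = (d + e - a) *+ 2 + (d + e - b) *+ 2 + (m - d) *+ 4).
    apply: ltr_wpDr; first by rewrite mulrn_wge0.
    by rewrite addr_gt0// pmulrn_lgt0.
  by ring.
(* Moving [v] by the best multiple of [w] stays in [C] and lowers the squared distance by the square
   of [|phi (x - v) w|] over [phi w w]; near-minimality allows a drop of at most [e]. *)
have B_orth e v w : B e v -> C w -> `|phi (x - v) w| ^+ 2 <= e * phi w w.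
  move=> [Cv ve] Cw; have [->|w_neq0] := eqVneq w 0.
    by rewrite !linear0r normr0 expr0n mulr0.
  have := d_le (v + (phi (x - v) w / phi w w) *: w) (CD _ _ Cv (CZ _ _ Cw)).
  rewrite opprD addrA /q dot_sub_proj// => d_le_q.
  rewrite -ler_pdivrMr; last exact: neq0_dnorm_gt0.
  by rewrite -(lerD2l d) (le_trans _ (ltW ve))// -lerBrDr.
pose F := filter_from [set e | 0 < e] B.
have FF : ProperFilter F.
  apply: filter_from_proper; last by move=> e; exact: B_neq0.
  apply: filter_from_filter; first by exists 1 => /=.
  have B_mono e e' : e <= e' -> B e `<=` B e'.
    by move=> ee' v [Cv ve]; split=> //; rewrite (lt_le_trans ve)// lerD2l.
  move=> e1 e2 /= e1_gt0 e2_gt0.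
  have [e12|/ltW e21] := real_leP (gtr0_real e1_gt0) (gtr0_real e2_gt0).
    by exists e1 => // v Bv; split=> //; exact: B_mono Bv.
  by exists e2 => // v Bv; split=> //; exact: B_mono Bv.
have [p Fp] : exists p : V, F --> p.
  apply: V_complete => e e_gt0.
  (* With this parameter [B_diam] gives the bound [4 * (e / 2) ^+ 2 = e ^+ 2]. *)
  have e1_gt0 : 0 < (e / 2) ^+ 2 by rewrite exprn_gt0 ?divr_gt0.
  have [v Bv] := B_neq0 _ e1_gt0; exists v, ((e / 2) ^+ 2) => // w Bw.
  rewrite -ball_normE /= -(ltr_pXn2r (n := 2))// ?nnegrE ?(ltW e_gt0)//.
  rewrite (le_lt_trans (phi_ge _))// (lt_le_trans (B_diam _ _ _ Bv Bw))//.
  by rewrite (_ : 4 * _ = e ^+ 2)//; field.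
have near_p e1 e2 : 0 < e1 -> 0 < e2 -> exists2 v, B e1 v & `|p - v| < e2.
  move=> e1_gt0 e2_gt0.
  have Fe1 : F (B e1) by exists e1.
  have Fe2 : F (ball p e2) by apply: Fp; exact: nbhsx_ballx.
  have [v [Bv]] := filter_ex (filterI Fe1 Fe2).
  by rewrite -ball_normE; exists v.
exists p.
  apply: Cclosed; apply/normed_closureP => e e_gt0.
  by have [v [Cv _] pv] := near_p 1 e ltr01 e_gt0; exists v.
move=> w Cw; apply: dot_eq0C.
have [k k_gt0 phik] := dot_bounded w.
apply/eqP; rewrite -normr_le0; apply/ler_addgt0Pr => e e_gt0; rewrite add0r.
have w_ge0 := dot_ge0 phi w.
(* Chosen so that [e1 * phi w w] is at most [(e / 2) ^+ 2]. The other half of [e] pays for replacing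
   [p] by [v]. *)
pose e1 := (e / 2) ^+ 2 / (phi w w + 1).
have e1_gt0 : 0 < e1 by rewrite divr_gt0 ?exprn_gt0 ?divr_gt0// ltr_wpDl.
have e2_gt0 : 0 < e / 2 / k by rewrite !divr_gt0.
have [v Bv pv] := near_p e1 _ e1_gt0 e2_gt0.
rewrite -[x - p](subrKA v) linearDl /= (splitr e).
rewrite (le_trans (ler_normD _ _))// lerD//.
  apply: ler_norm_of_sqr; first by rewrite divr_ge0// ltW.
  rewrite (le_trans (B_orth _ _ _ Bv Cw))// -mulrA ger_pMr ?exprn_gt0 ?divr_gt0//.
  by rewrite mulrC ler_pdivrMr ?ltr_wpDl// mul1r lerDl.
by rewrite (le_trans (phik _))// mulrC -ler_pdivlMr// distrC ltW.
Qed.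

(** For [v] in the double complement with projection [p] on the closure of [D], [v - p] is
    orthogonal to [D], hence to both [v] and [p], hence to itself. *)
Lemma closure_perp2 D : Defs.subspace D -> closure D = perp phi (perp phi D).
Proof.
move=> Dsub; apply/seteqP; split=> [v|v DDv].
  by move/(closureS (@sub_perp2 _ phi D)); exact: closed_perp.
have [p Dp pv] := projection v (closure_subspace Dsub) (@closed_closure _ D).
suff -> : v = p by [].
apply/eqP; rewrite -subr_eq0; apply/eqP/(dot_eq0 (phi := phi)).
rewrite linearBr /= (dot_eq0C (pv _ Dp)) subr0 DDv// => u Du.
exact/pv/subset_closure.
Qed.

End Completeness.
End DotForms.

(** * The inner product on a product space *)

Section PairForm.
Context {K : numFieldType} {theta : involutive_rmorphism K}.
Context {U V : lmodType K} (f : {dot U for theta}) (g : {dot V for theta}).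

Definition pair_form (u v : U * V) : K := f u.1 v.1 + g u.2 v.2.

Lemma pair_form_bilinear : bilinear_for
  (GRing.Scale.Law.clone _ _ *%R _) (GRing.Scale.Law.clone _ _ (theta \; *%R) _)
  pair_form.
Proof.
split=> u a v w; rewrite /pair_form /=.
  by rewrite !linearPl mulrDr addrACA.
by rewrite !linearPr /= mulrDr addrACA.
Qed.

HB.instance Definition _ := bilinear_isBilinear.Build
  K (U * V)%type (U * V)%type K _ _ pair_form pair_form_bilinear.

Lemma pair_form_herm u v : pair_form u v = (-1) ^+ false * theta (pair_form v u).
Proof.
by rewrite /pair_form rmorphD /= mulrDr -(hermC f) -(hermC g).
Qed.

HB.instance Definition _ := isHermitianSesquilinear.Build
  K (U * V)%type false theta pair_form pair_form_herm.

Lemma pair_form_gt0 u : u != 0 -> 0 < pair_form u u.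
Proof.
case: u => u v uv_neq0; rewrite /pair_form /=.
have [u0|u_neq0] := eqVneq u 0.
  rewrite u0 linear0l add0r neq0_dnorm_gt0//.
  by apply: contra_neq uv_neq0 => ->; rewrite u0.
by rewrite ltr_pwDl ?dot_ge0// neq0_dnorm_gt0.
Qed.

HB.instance Definition _ := isDotProduct.Build
  K (U * V)%type pair_form pair_form_gt0.

End PairForm.

(** * Uniform boundedness in a Hilbert space *)

Section Hilbert.
Context {K : numFieldType} {theta : involutive_rmorphism K}.
Hypothesis theta_norm : forall a : K, a * theta a = `|a| ^+ 2.
Hypothesis K_unbounded : nat_unbounded K.
Context (H : hilbertSpace theta).

Lemma inner_norm_le (x y : H) : `|inner H x y| <= `|x| * `|y|.
Proof.
apply: ler_norm_of_sqr; first by rewrite mulr_ge0.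
by rewrite exprMn -!inner_norm (dot_CauchySchwarz theta_norm).
Qed.

(* One of the points z + h, z - h works, where h is a multiple of u of norm r.
   This is the step of Sokal's gliding hump proof of uniform boundedness. *)
Lemma inner_sphere_large (z u : H) (r : K) : u != 0 -> 0 <= r ->
  exists2 z', `|z' - z| <= r & r * `|u| <= `|inner H z' u|.
Proof.
move=> u_neq0 r_ge0; pose h := (r / `|u|) *: u.
have u_gt0 : 0 < `|u| by rewrite normr_gt0.
have hr : `|h| = r.
  by rewrite normrZ normrM normfV normr_id divfK ?gt_eqF// ger0_norm.
have hu : inner H h u = r * `|u|.
  by rewrite linearZl_LR /= inner_norm; field; rewrite gt_eqF.
have ru_real : r * `|u| \is Num.real by rewrite realM ?ger0_real.
have [le_r|lt_r] := real_leP ru_real (normr_real (inner H (z + h) u)).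
  by exists (z + h) => //; rewrite addrAC subrr add0r hr.
exists (z - h); first by rewrite addrAC subrr add0r normrN hr.
rewrite -(lerD2l (r * `|u|)).
have -> : r * `|u| + r * `|u| = `|inner H (z + h) u - inner H (z - h) u|.
  rewrite linearDl linearBl /= hu (_ : _ - _ = r * `|u| + r * `|u|); last by ring.
  by rewrite ger0_norm// addr_ge0 ?mulr_ge0.
by rewrite (le_trans (ler_normB _ _))// lerD2r ltW.
Qed.

(** The bound [3 / 2 * 3 ^- n] is the sum of the geometric tail starting at [3 ^- n]. *)
Lemma geometric_steps_cvg (z : nat -> H) :
  (forall n, `|z n.+1 - z n| <= 3 ^- n) ->
  exists l, forall n, `|l - z n| <= 3 / 2 * 3 ^- n.
Proof.
move=> z_step.
(* The second summand is the tail not yet spent; carrying it along makes the induction close. *)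
have z_dist n m : `|z (n + m)%N - z n| + 3 / 2 * 3 ^- (n + m) <= 3 / 2 * 3 ^- n.
  elim: m => [|m IH]; first by rewrite addn0 subrr normr0 add0r.
  rewrite addnS (le_trans _ IH)//.
  have tri : `|z (n + m).+1 - z n| <= 3 ^- (n + m) + `|z (n + m)%N - z n|.
    by rewrite -(subrKA (z (n + m)%N)) (le_trans (ler_normD _ _))// lerD2r.
  rewrite (le_trans (lerD tri (lexx _)))// addrAC addrC lerD2l.
  rewrite exprS invfM le_eqVlt; apply/orP; left; apply/eqP.
  by field; rewrite expf_neq0 ?pnatr_eq0.
have {}z_dist n m : (n <= m)%N -> `|z m - z n| <= 3 / 2 * 3 ^- n.
  move=> nm; rewrite -[m in z m](subnKC nm) (le_trans _ (z_dist n (m - n)%N))//.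
  by rewrite lerDl mulr_ge0 ?divr_ge0 ?invr_ge0 ?exprn_ge0.
have [e e_gt0|l zl] := complete_normedModType (F := z @ \oo).
  have [N Ne] := K_unbounded (3 / 2 / e).
  exists (z N); exists N => // n /= Nn.
  rewrite -ball_normE /= distrC (le_lt_trans (z_dist _ _ Nn))//.
  rewrite ltr_pdivrMr ?exprn_gt0// [e * _]mulrC -ltr_pdivrMr//.
  rewrite ger0_norm ?divr_ge0 ?(ltW e_gt0)// in Ne; rewrite (lt_le_trans Ne)//.
  have /ltnW : (N < 3 ^ N)%N by exact: ltn_expl.
  by rewrite -(ler_nat K) natrX.
exists l => n; apply/ler_addgt0Pr => e e_gt0.
have [N _ Ne] := zl _ (nbhsx_ballx l e e_gt0).
have := Ne _ (leq_maxl N n); rewrite -ball_normE /= => lt_e.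
rewrite -(subrKA (z (maxn N n))) (le_trans (ler_normD _ _))// addrC.
by rewrite lerD ?z_dist ?leq_maxr// ltW.
Qed.

(** Otherwise choose [u (k n)] of rapidly growing norm and move [z n] by at most [3 ^- n] to a point
    pairing with [u (k n)] to at least [3 ^- n * |u (k n)|]. All later moves together undo at most
    half of this, so the pairings of the limit with the family are unbounded. *)
Lemma uniform_boundedness (I : Type) (u : I -> H) :
  (forall z, exists M : K, forall i, `|inner H z (u i)| <= M) ->
  exists M : K, forall i, `|u i| <= M.
Proof.
move=> u_ptw; apply: contrapT => u_unb.
have /choice[k ku] : forall n, exists i, n%:R * 2 * 3 ^+ n < `|u i|.
  move=> n; apply: contrapT => u_le; apply: u_unb.
  exists (n%:R * 2 * 3 ^+ n) => i.
  have := @real_leP _ `|u i| (n%:R * 2 * 3 ^+ n).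
  case=> //; rewrite ?normr_real ?realM ?realX ?realn// => u_lt.
  by case: u_le; exists i.
have u_neq0 n : u (k n) != 0.
  by rewrite -normr_gt0 (le_lt_trans _ (ku n))// !mulr_ge0 ?exprn_ge0.
have r_ge0 n : 0 <= 3 ^- n :> K by rewrite invr_ge0 exprn_ge0.
pose step n z := sval (cid2 (inner_sphere_large z (u_neq0 n) (r_ge0 n))).
have stepP n z : `|step n z - z| <= 3 ^- n /\
    3 ^- n * `|u (k n)| <= `|inner H (step n z) (u (k n))|.
  by rewrite /step; case: cid2.
pose z := fix z n := if n is m.+1 then step m (z m) else 0.
have [l zl] := @geometric_steps_cvg z (fun n => (stepP n (z n)).1).
have [M Ml] := u_ptw l; have [n Mn] := K_unbounded M.
have M_ge0 : 0 <= M by exact: le_trans (Ml (k n)).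
suff : n%:R < M by move/(lt_trans Mn); rewrite ger0_norm// ltxx.
apply: lt_le_trans (Ml (k n)).
(* The added term bounds the effect of the moves after step [n]. It is half of [3 ^- n * |u (k n)|],
   and the remaining half exceeds [n] by the choice of [k]. *)
rewrite -(ltrD2l (3 / 2 * 3 ^- n.+1 * `|u (k n)|)).
apply: (@lt_le_trans _ _ (3 ^- n * `|u (k n)|)).
  rewrite -[3 ^- n](_ : 3 / 2 * 3 ^- n.+1 + 2^-1 * 3 ^- n = _); last first.
    by rewrite exprS invfM; field; rewrite expf_neq0 ?pnatr_eq0.
  rewrite [ltRHS]mulrDl ltrD2l -mulrA mulrCA -ltr_pdivrMl ?invr_gt0 ?exprn_gt0//.
  rewrite invrK -ltr_pdivrMl ?invr_gt0// invrK.
  by rewrite (_ : 2 * _ = n%:R * 2 * 3 ^+ n)//; ring.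
rewrite (le_trans (stepP n (z n)).2)// -(subrK l (step n (z n))) linearDl /=.
rewrite (le_trans (ler_normD _ _))// lerD2r (le_trans (inner_norm_le _ _))//.
by rewrite ler_wpM2r// distrC; exact: (zl n.+1).
Qed.

End Hilbert.

(** * Operators as subspaces of a product of Hilbert spaces *)

(** Compares the maximum norm of a product with the norm coming from [pairing], giving the constants
    1 and 2. *)
Lemma max_sqr_le_addn (K : numFieldType) (a b : K) : 0 <= a -> 0 <= b ->
  Num.max a b ^+ 2 <= a ^+ 2 + b ^+ 2 /\
  a ^+ 2 + b ^+ 2 <= 2 * Num.max a b ^+ 2.
Proof.
move=> a_ge0 b_ge0; have ab := @real_leP _ a b (ger0_real a_ge0) (ger0_real b_ge0).
rewrite mulr_natl mulr2n.
case: ab => ab; rewrite ?lerDl ?lerDr ?exprn_ge0 ?lerD2l ?lerD2r//.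
  by split=> //; rewrite ler_pXn2r.
by split=> //; rewrite ler_pXn2r// ltW.
Qed.

Section Operators.
Context {K : numFieldType} {theta : involutive_rmorphism K}.
Hypothesis theta_norm : forall a : K, a * theta a = `|a| ^+ 2.
Hypothesis K_inf : has_infima K.
Hypothesis K_unbounded : nat_unbounded K.
Implicit Types U V : hilbertSpace theta.

Definition pairing U V : {dot (U * V)%type for theta} :=
  pair_form (inner U) (inner V).

Lemma pairingE U V (p q : (U * V)%type) :
  pairing U V p q = inner U p.1 q.1 + inner V p.2 q.2.
Proof. by []. Qed.

Lemma pairing_ge U V (u : (U * V)%type) : `|u| ^+ 2 <= pairing U V u u.
Proof.
case: u => x y; rewrite pairingE /= !inner_norm.
by have [] := max_sqr_le_addn (normr_ge0 x) (normr_ge0 y).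
Qed.

Lemma pairing_le U V (u : (U * V)%type) : pairing U V u u <= 2 * `|u| ^+ 2.
Proof.
case: u => x y; rewrite pairingE /= !inner_norm.
by have [] := max_sqr_le_addn (normr_ge0 x) (normr_ge0 y).
Qed.

Lemma complete_pairing U V : complete_space (U * V)%type.
Proof. by apply: complete_prod; exact: complete_normedModType. Qed.

Lemma inner_le U (x : U) : inner U x x <= 1 * `|x| ^+ 2.
Proof. by rewrite mul1r inner_norm. Qed.

Lemma inner_ge U (x : U) : `|x| ^+ 2 <= inner U x x.
Proof. by rewrite inner_norm. Qed.

Lemma closure_inner U (D : set U) : Defs.subspace D ->
  closure D = perp (inner U) (perp (inner U) D).
Proof.
move=> Dsub.
exact: (closure_perp2 theta_norm K_inf (@complete_normedModType K U)
  (ler01 : 0 <= 1 :> K) (@inner_ge U) (@inner_le U) Dsub).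
Qed.

Lemma closure_pairing U V (D : set (U * V)) : Defs.subspace D ->
  closure D = perp (pairing U V) (perp (pairing U V) D).
Proof.
move=> Dsub.
exact: (closure_perp2 theta_norm K_inf (@complete_pairing U V)
  (ler0n _ 2) (@pairing_ge U V) (@pairing_le U V) Dsub).
Qed.

Lemma closed_perp_pairing U V (D : set (U * V)) : closed (perp (pairing U V) D).
Proof. exact: (closed_perp theta_norm (ler0n _ 2) (@pairing_le U V)). Qed.

Lemma closed_perp_inner U (D : set U) : closed (perp (inner U) D).
Proof. exact: (closed_perp theta_norm ler01 (@inner_le U)). Qed.

Lemma opp_adjointE U V (T : set (U * V)) y x :
  opp_op (adjoint T) (y, x) <-> perp (pairing U V) T (x, y).
Proof.
split=> [Tyx [u v] /Tyx /= uv|Tyx u v /Tyx /=]; rewrite pairingE /=.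
  by rewrite uv linearNr /= subrr.
by move=> /eqP; rewrite addrC addr_eq0 -linearNr => /eqP.
Qed.

Lemma linear_operator_subspace U V (T : set (U * V)) :
  linear_operator T -> Defs.subspace T.
Proof. by move=> [T0 TP _]; split=> // a [x y] [x' y']; exact: TP. Qed.

Lemma dot_closure_eq0 U (D : set U) x y :
  (forall u, D u -> inner U u x = 0) -> closure D y -> inner U y x = 0.
Proof.
move=> Dx Dy; apply: dot_eq0C.
apply: (closed_perp_inner (D := [set x])) => //.
by apply: closureS Dy => u Du _ ->; apply/dot_eq0C/Dx.
Qed.

Lemma perp_dense U (D : set U) x : dense D -> perp (inner U) D x -> x = 0.
Proof.
move=> Ddense Dx; apply: (dot_eq0 (phi := inner U)).
apply: (dot_closure_eq0 Dx) => B; rewrite nbhsE => -[O [Oopen Ox] OB].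
have [y [Oy Dy]] := Ddense O (ex_intro _ x Ox) Oopen.
by exists y; split=> //; exact: OB.
Qed.

(** * The operators [A], [A0] and [A#] *)

Section OnePair.
Context {U V : hilbertSpace theta} (a : set (U * V)) (b : set (V * U)).
Hypotheses (a_linear : linear_operator a) (b_dense : densely_defined b).
Hypothesis ab : a `<=` opp_op (adjoint b).

Let A := opp_op (adjoint b).
Let A0 := closure_op a.
Let B := opp_op (adjoint a).

(** Linearity holds as for any orthogonal complement; single-valuedness is where density of [dom b]
    enters. *)
Lemma opp_adjoint_linear : linear_operator A.
Proof.
split.
- by apply/opp_adjointE => u _; exact: linear0r.
- move=> t x y x' y' /opp_adjointE xy /opp_adjointE x'y'.
  apply/opp_adjointE; exact: (perp_subspace _ _).2 xy x'y'.
- move=> x y y' /opp_adjointE xy /opp_adjointE xy'.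
  apply/eqP; rewrite -subr_eq0; apply/eqP/(perp_dense b_dense) => z [w bzw].
  have := xy _ bzw; have := xy' _ bzw; rewrite !pairingE /= linearBr /=.
  move=> /eqP; rewrite addr_eq0 => /eqP -> /eqP; rewrite addr_eq0 => /eqP ->.
  exact: subrr.
Qed.

Lemma closure_perp0 p q : A0 p -> perp (pairing U V) a q -> pairing U V p q = 0.
Proof.
move=> A0p aq; apply: dot_eq0C.
apply: (closed_perp_pairing (D := [set q])) => //.
by apply: closureS A0p => u Du _ ->; apply/dot_eq0C/aq.
Qed.

Lemma closure_sub_opp_adjoint : A0 `<=` A.
Proof.
move=> [x y] A0xy; apply/opp_adjointE => -[v u] bvu.
have : perp (pairing U V) a (u, v).
  move=> [x' y'] /ab /opp_adjointE /(_ _ bvu) /dot_eq0C.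
  by rewrite pairingE /= addrC.
by move=> /(closure_perp0 A0xy) /dot_eq0C; rewrite pairingE /= addrC.
Qed.

(** A vector [n] is orthogonal to [ran a] iff [(0, n)] is orthogonal to [a], that is, iff [B n = 0].
    The right-hand side is thus the double complement of [ran a]. *)
Lemma closure_ranP y :
  closure (ran A0) y <-> forall n, B (n, 0) -> inner V n y = 0.
Proof.
split=> [ay n /opp_adjointE an|By].
  apply: dot_eq0C; apply: dot_closure_eq0 ay => z [x A0xz].
  by have := closure_perp0 A0xz an; rewrite pairingE /= linear0r add0r.
have [a0 aP _] := a_linear.
have : closure (ran a) y.
  rewrite closure_inner => [n na|].
    apply: By; apply/opp_adjointE => -[x z] axz.
    by rewrite pairingE /= linear0r add0r na//; exists x.
  split; first by exists 0.
  by move=> t z z' [x axz] [x' ax'z']; exists (t *: x + x'); exact: aP.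
by apply: closureS => z [x axz]; exists x; exact: subset_closure.
Qed.

Lemma sharpE x y : sharp A A0 (x, y) <-> A (x, y) /\ closure (ran A0) y.
Proof.
split=> [[/= Axy [y' Axy' y'N]]|[Axy yN]].
  by split=> //; have [_ _ Afun] := opp_adjoint_linear; rewrite (Afun _ _ _ Axy Axy').
by split=> //; exists y.
Qed.

Lemma closure_sub_sharp : A0 `<=` sharp A A0.
Proof.
move=> [x y] A0xy; apply/sharpE; split; first exact: closure_sub_opp_adjoint.
by apply: subset_closure; exists x.
Qed.

Lemma ker_sub_sharp u : A (u, 0) -> sharp A A0 (u, 0).
Proof.
by move=> Au; apply/sharpE; split=> //; apply/closure_ranP => n _; exact: linear0r.
Qed.

Lemma sharp_subspace : Defs.subspace (sharp A A0).
Proof.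
have [A00 AP _] := opp_adjoint_linear.
split=> [|t [x y] [x' y'] /sharpE[Axy yN] /sharpE[Axy' yN']].
  exact: ker_sub_sharp.
apply/sharpE; split; first exact: AP.
apply/closure_ranP => n Bn; rewrite linearPr /=.
by rewrite !(closure_ranP _).1 // mulr0 addr0.
Qed.

End OnePair.

(** * The closure of [A0 + ker A x 0] and the core criterion *)

Section TwoPairs.
Context {U V : hilbertSpace theta} (a : set (U * V)) (b : set (V * U)).
Hypotheses (a_linear : linear_operator a) (b_linear : linear_operator b).
Hypotheses (a_dense : densely_defined a) (b_dense : densely_defined b).
Hypothesis ab : a `<=` opp_op (adjoint b).

Let A := opp_op (adjoint b).
Let B := opp_op (adjoint a).
Let A0 := closure_op a.
Let B0 := closure_op b.
Let As := sharp A A0.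
Let Bs := sharp B B0.
(** As a graph this is [A0 + ker A x 0]. *)
Let T := restr_op As (sumset (ker A) (dom A0)).

Lemma opp_adjoint_sym : b `<=` B.
Proof.
move=> [y x] byx; apply/opp_adjointE => -[x' y'] /ab /opp_adjointE /(_ _ byx).
by move=> /dot_eq0C; rewrite !pairingE /= addrC.
Qed.

Lemma closure_op_subspace : Defs.subspace A0.
Proof. exact/closure_subspace/linear_operator_subspace. Qed.

Lemma ker_dom_subspace : Defs.subspace (sumset (ker A) (dom A0)).
Proof.
have [A00 AP _] := opp_adjoint_linear b_dense.
have [A000 A0P] := closure_op_subspace.
split; first by exists 0, 0; split=> //; [exists 0 | rewrite addr0].
move=> t _ _ [u [v [Au [w A0v] ->]]] [u' [v' [Au' [w' A0v'] ->]]].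
exists (t *: u + u'), (t *: v + v'); split.
- by have := AP t _ _ _ _ Au Au'; rewrite scaler0 addr0.
- by exists (t *: w + w'); exact: (A0P t (v, w) (v', w')).
- by rewrite scalerDr addrACA.
Qed.

Lemma core_restr_subspace : Defs.subspace T.
Proof.
have [As0 AsP] := sharp_subspace a_linear b_dense.
have [D0 DP] := ker_dom_subspace.
split=> // t [x y] [x' y'] [Axy Dx] [Axy' Dx']; split.
  exact: (AsP t (x, y) (x', y')).
exact: DP.
Qed.

Lemma ker_dom_sub_dom : sumset (ker A) (dom A0) `<=` dom As.
Proof.
move=> _ [u [v [Au [w A0v] ->]]]; exists (0 + w).
have [_ AsP] := sharp_subspace a_linear b_dense.
have := AsP 1 (u, 0) (v, w) (ker_sub_sharp a_linear b_dense Au)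
  (closure_sub_sharp b_dense ab A0v).
by rewrite /= scale1r.
Qed.

(** For [x = u + v] with [u] in [ker A] and [A0 v = w], the value at [x] is [w]. If [Bs n = m], then
    [(v, w)] is orthogonal to [(m, n)] because [B n = m], and [u] is orthogonal to [m] because [m]
    lies in the closure of [ran B0]. *)
Lemma core_restr_sub : T `<=` opp_op (adjoint Bs).
Proof.
move=> [x y] [Asxy [u [v [Au [w A0v] /= xE]]]].
have yw : y = w.
  have [Axy _] := (sharpE _ b_dense _ _).1 Asxy.
  have [_ AP Afun] := opp_adjoint_linear b_dense.
  have := AP 1 _ _ _ _ Au (closure_sub_opp_adjoint ab A0v).
  by rewrite scaler0 add0r scale1r -xE; exact: Afun Axy.
subst x y; apply/opp_adjointE => -[n m] /(sharpE _ a_dense)[Bnm mM].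
have /dot_eq0C := closure_perp0 A0v ((opp_adjointE _ _ _).1 Bnm).
rewrite !pairingE /= linearDr /= addrCA [inner V n w + _]addrC => ->.
by rewrite addr0; apply/dot_eq0C/((closure_ranP b_linear _).1 mM).
Qed.

(** Testing against [a] gives [B y = x]; testing against [ker A x 0] puts [x] in the closure of
    [ran B0]. *)
Lemma perp_core_restr x y : perp (pairing U V) T (x, y) -> Bs (y, x).
Proof.
move=> Txy; apply/(sharpE _ a_dense); split.
  apply/opp_adjointE => -[v w] avw; apply: Txy.
  have A0v : A0 (v, w) by exact: subset_closure.
  split; first exact: (closure_sub_sharp b_dense ab).
  exists 0, v; split; last by rewrite add0r.
    by have [] := opp_adjoint_linear b_dense.
  by exists w.
apply/(closure_ranP b_linear) => m Am.
have := Txy (m, 0); rewrite pairingE /= linear0l addr0; apply.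
split; first exact: ker_sub_sharp.
exists m, 0; split=> //; last by rewrite addr0.
by exists 0; have [] := closure_op_subspace.
Qed.

Lemma opp_adjoint_perp (S : set (V * U)) :
  opp_op (adjoint S) = perp (pairing U V) [set q | S (q.2, q.1)].
Proof.
apply/seteqP; split=> -[x y].
  by move=> /opp_adjointE Sxy [m n] /= /Sxy; rewrite !pairingE /= addrC.
move=> Sxy; apply/opp_adjointE => -[n m] Snm.
by have := Sxy (m, n) Snm; rewrite !pairingE /= addrC.
Qed.

(** The closure of [T] is its double complement, and the complement of [T] lies in the swapped graph
    of [Bs]. The other inclusion holds because a complement is closed. *)
Lemma closure_core_restr : closure_op T = opp_op (adjoint Bs).
Proof.
apply/seteqP; split.
  rewrite opp_adjoint_perp => p Tp; apply: closed_perp_pairing.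
  by apply: closureS Tp; rewrite -opp_adjoint_perp; exact: core_restr_sub.
move=> p; rewrite opp_adjoint_perp => Bp.
rewrite /closure_op closure_pairing; last exact: core_restr_subspace.
by move=> [x y] /perp_core_restr Bsyx; exact: Bp.
Qed.

(** [Bs] contains [b] and [ker B x 0]. Orthogonality to the first gives membership in [A], to the
    second the range condition. *)
Lemma opp_adjoint_sharp_sub : opp_op (adjoint Bs) `<=` As.
Proof.
move=> [x y] /opp_adjointE Bsyx; apply/(sharpE _ b_dense); split.
  apply/opp_adjointE => -[v u] bvu; apply: Bsyx.
  apply: (closure_sub_sharp a_dense opp_adjoint_sym).
  exact: subset_closure.
apply/(closure_ranP a_linear) => n Bn.
have := Bsyx (n, 0); rewrite pairingE /= linear0l addr0; apply.
exact: (ker_sub_sharp b_linear a_dense).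
Qed.

Lemma core_iff : opp_op (adjoint Bs) = As <-> core As (sumset (ker A) (dom A0)).
Proof.
rewrite -closure_core_restr; split=> [TA|[]//].
by split=> //; [exact: ker_dom_subspace | exact: ker_dom_sub_dom].
Qed.

(** * The eigenvalue criterion *)

Lemma eigenvalue1P : eigenvalue_op (comp_op Bs As) 1 <->
  exists x y, [/\ x != 0, As (x, y) & Bs (y, x)].
Proof.
split=> [[x x_neq0 [y /=]]|[x [y [x_neq0 Asxy Bsyx]]]].
  by rewrite scale1r => Asxy Bsyx; exists x, y.
by exists x => //; exists y => //=; rewrite scale1r.
Qed.

(** If (i) holds, an eigenvector [x] gives a pair [(x, y)] orthogonal to itself. Conversely, project
    an element of [As] on the closure of [T]: the remainder lies in [As] and, swapped, in [Bs]. *)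
Lemma eigenvalue_iff :
  opp_op (adjoint Bs) = As <-> ~ eigenvalue_op (comp_op Bs As) 1.
Proof.
split=> [BsAs /eigenvalue1P[x [y [/eqP x_neq0 Asxy Bsyx]]]|no_eigen].
  apply: x_neq0; move: Asxy; rewrite -BsAs => /opp_adjointE /(_ _ Bsyx).
  by move=> /dot_eq0 [].
apply/seteqP; split=> [|p Asp]; first exact: opp_adjoint_sharp_sub.
have Csub : Defs.subspace (closure T).
  by apply: closure_subspace; exact: core_restr_subspace.
have [q Cq Cpq] := projection theta_norm K_inf (@complete_pairing U V)
  (ler0n K 2) (@pairing_ge U V) (@pairing_le U V) p Csub (@closed_closure _ T).
rewrite -closure_core_restr.
suff -> : p = q by [].
have Asq : As q.
  by apply: opp_adjoint_sharp_sub; rewrite -closure_core_restr.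
have Asd : As (p - q).
  have [_ AsP] := sharp_subspace a_linear b_dense.
  by have := AsP (-1) _ _ Asq Asp; rewrite scaleN1r addrC.
have : perp (pairing U V) T (p - q).
  by move=> r Tr; apply: Cpq; exact: subset_closure.
case: (p - q) (subr_eq0 p q) Asd => [x y] pq Asxy /perp_core_restr Bsyx.
(* An eigenvector must be nonzero; if [x = 0], then [y = 0] by single-valuedness of [A]. *)
have [x0|x_neq0] := eqVneq x 0; last by case: no_eigen; apply/eigenvalue1P; exists x, y.
apply/eqP; rewrite -pq; move: Asxy; rewrite x0 => /(sharpE _ b_dense)[A0y _].
have [A00 _ Afun] := opp_adjoint_linear b_dense.
by rewrite (Afun _ _ _ A0y A00).
Qed.

(** * The case of closed range *)

Lemma closed_range_no_eigenvector x y : closed (ran As) ->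
  As (x, y) -> Bs (y, x) -> x = 0.
Proof.
move=> ran_closed Asxy /(sharpE _ a_dense)[Byx xM].
have [Axy yN] := (sharpE _ b_dense _ _).1 Asxy.
pose N := closure (ran A0).
have ranAs z : N z -> exists s, As (s, z).
  move=> Nz; apply: ran_closed; apply: closureS Nz => w [v A0vw].
  by exists v; exact: (closure_sub_sharp b_dense ab).
have orth s z w v : As (s, z) -> B0 (w, v) -> inner U s v = - inner V z w.
  move=> /(sharpE _ b_dense)[/opp_adjointE Asz _] B0wv.
  have /dot_eq0C /eqP := closure_perp0 B0wv Asz.
  by rewrite pairingE /= addrC addr_eq0 => /eqP.
have Nsub : Defs.subspace N.
  have [A00 A0P] := closure_op_subspace.
  apply: closure_subspace; split; first by exists 0.
  move=> t z z' [s A0sz] [s' A0sz']; exists (t *: s + s').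
  exact: (A0P t (s, z) (s', z')).
have /choice[P PN] : forall w, exists p, N p /\ perp (inner V) N (w - p).
  move=> w.
  have [p Np wp] := projection theta_norm K_inf (@complete_normedModType K V)
    ler01 (@inner_ge V) (@inner_le V) w Nsub (@closed_closure _ _).
  by exists p.
(* Staying within distance 1 of [x] keeps the values [v] bounded, which gives the pointwise
   bounds. *)
pose I := {p : V * U | B0 p /\ `|x - p.2| < 1}.
have [|M PM] := uniform_boundedness theta_norm K_unbounded
    (u := fun i : I => P (sval i).1).
  move=> z.
  have [s Assz] := ranAs (P z) (PN z).1.
  exists (`|s| * (`|x| + 1)) => -[[w v] [/= B0wv xv]].
  (* The projection [P] is self-adjoint, which moves it to [z], where [P z] is a value of [As]. *)
  have -> : inner V z (P w) = inner V (P z) w.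
    rewrite -[z in LHS](subrK (P z)) -[w in RHS](subrK (P w)) linearDl linearDr /=.
    by rewrite ((PN w).2 _ (PN z).1) (dot_eq0C ((PN z).2 _ (PN w).1)).
  rewrite -[inner V (P z) w]opprK -(orth _ _ _ _ Assz B0wv) normrN.
  rewrite (le_trans (inner_norm_le theta_norm _ _))//.
  rewrite ler_wpM2l// -[v](subKr x) (le_trans (ler_normB _ _))// lerD2l.
  exact: ltW.
(* The index set is nonempty, as [x] lies in the closure of [ran B0]. *)
have M_ge0 : 0 <= M.
  have [v [w B0wv] xv] := (normed_closureP _ _).1 xM 1 ltr01.
  exact: le_trans (PM (exist _ (w, v) (conj B0wv xv))).
have bound s z : As (s, z) -> `|inner U s x| <= M * `|z|.
  move=> Assz; apply/ler_addgt0Pr => e e_gt0.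
  (* Dividing [e] by this quantity makes both [|x - v| < 1] and [|s| * |x - v| <= e]. *)
  have c_gt0 : 0 < `|s| + 1 + e by rewrite ltr_wpDl ?addr_ge0.
  have [|v [w B0wv] xv] := (normed_closureP _ _).1 xM (e / (`|s| + 1 + e)).
    by rewrite divr_gt0.
  have xv1 : `|x - v| < 1.
    rewrite (lt_le_trans xv)// ler_pdivrMr// mul1r lerDr.
    by rewrite addr_ge0.
  have Pw := PM (exist _ (w, v) (conj B0wv xv1)); rewrite /= in Pw.
  rewrite -[x](subrK v) linearDr /= addrC (orth _ _ _ _ Assz B0wv).
  rewrite (le_trans (ler_normD _ _))// normrN lerD//.
    have zN : N z by have [] := (sharpE _ b_dense _ _).1 Assz.
    rewrite -[w](subrK (P w)) linearDr /= ((PN w).2 _ zN) add0r.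
    rewrite (le_trans (inner_norm_le theta_norm _ _))// mulrC.
    by rewrite ler_wpM2r.
  rewrite (le_trans (inner_norm_le theta_norm _ _))//.
  rewrite (le_trans (ler_wpM2l (normr_ge0 _) (ltW xv)))// mulrCA ger_pMr//.
  by rewrite ler_pdivrMr// mul1r -addrA lerDl addr_ge0 ?ltW.
apply: (dot_eq0 (phi := inner U)); apply/eqP; rewrite eq_le dot_ge0 andbT.
rewrite (@le_trans _ _ (inner V y y + inner U x x)) ?lerDr ?dot_ge0//.
apply/ler_addgt0Pr => e e_gt0; rewrite add0r.
(* The final error is [(M + |y|) * |y - y'|]; adding 1 keeps the divisor positive. *)
have c_gt0 : 0 < M + `|y| + 1 by rewrite ltr_wpDl ?addr_ge0.
have [|y' [x' A0x'y'] yy'] := (normed_closureP _ _).1 yN (e / (M + `|y| + 1)).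
  by rewrite divr_gt0.
have Asd : As (x' - x, y' - y).
  have [_ AsP] := sharp_subspace a_linear b_dense.
  have := AsP (-1) _ _ Asxy (closure_sub_sharp b_dense ab A0x'y').
  by rewrite scaleN1r addrC.
have A0B : inner U x' x = - inner V y' y.
  have /eqP := closure_perp0 A0x'y' ((opp_adjointE _ _ _).1 Byx).
  by rewrite pairingE /= addr_eq0 => /eqP.
have E : inner V y y + inner U x x = inner V (y - y') y - inner U (x' - x) x.
  by rewrite linearBl linearBl /= A0B; ring.
have yx_ge0 : 0 <= inner V y y + inner U x x by rewrite addr_ge0 ?dot_ge0.
rewrite -(ger0_norm yx_ge0) E (le_trans (ler_normB _ _))//.
rewrite (le_trans (lerD (inner_norm_le theta_norm _ _) (bound _ _ Asd)))//.
rewrite [`|y' - y|]distrC mulrC -mulrDl [_ + M]addrC.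
rewrite (le_trans (ler_wpM2l _ (ltW yy'))) ?addr_ge0// mulrCA ger_pMr//.
by rewrite ler_pdivrMr// mul1r lerDl.
Qed.

Lemma sharp_core_eigenvalue :
  [/\ opp_op (adjoint Bs) `<=` As,
      (opp_op (adjoint Bs) = As <-> core As (sumset (ker A) (dom A0))) /\
      (core As (sumset (ker A) (dom A0)) <-> ~ eigenvalue_op (comp_op Bs As) 1)
    & closed (ran As) ->
      [/\ opp_op (adjoint Bs) = As, core As (sumset (ker A) (dom A0))
        & ~ eigenvalue_op (comp_op Bs As) 1]].
Proof.
have i_iff_ii := core_iff; have i_iff_iii := eigenvalue_iff.
split; first exact: opp_adjoint_sharp_sub.
  by split=> //; rewrite -i_iff_ii.
move=> ran_closed.
have iii : ~ eigenvalue_op (comp_op Bs As) 1.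
  move=> /eigenvalue1P[x [y [/eqP x_neq0 Asxy Bsyx]]].
  exact/x_neq0/(closed_range_no_eigenvector ran_closed Asxy Bsyx).
by split=> //; [|rewrite -i_iff_ii]; exact/i_iff_iii.
Qed.

End TwoPairs.
End Operators.

(** * Specialisation to real and complex scalars *)

Theorem theorem3p9 (R : realType) (K : numFieldType) (conj : K -> K)
    (K_real_or_complex : real_or_complex R conj)
    (H0 H1 : hilbertSpace conj)
    (Ac : set (H0 * H1)) (Bc : set (H1 * H0))
    (Ac_linear : linear_operator Ac) (Bc_linear : linear_operator Bc)
    (Ac_dense : densely_defined Ac) (Bc_dense : densely_defined Bc)
    (AcBc : Ac `<=` opp_op (adjoint Bc)) :
  let A0 := closure_op Ac in
  let B0 := closure_op Bc in
  let A := opp_op (adjoint Bc) in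
  let B := opp_op (adjoint Ac) in
  let As := sharp A A0 in
  let Bs := sharp B B0 in
  let stmt_i := opp_op (adjoint Bs) = As in
  let stmt_ii := core As (sumset (ker A) (dom A0)) in
  let stmt_iii := ~ eigenvalue_op (comp_op Bs As) 1 in
  [/\ opp_op (adjoint Bs) `<=` As,
      (stmt_i <-> stmt_ii) /\ (stmt_ii <-> stmt_iii)
    & closed (ran As) -> [/\ stmt_i, stmt_ii & stmt_iii]].
Proof.
(* All data depending on the field are generalised first, so that the case analysis can substitute
   the field and its conjugation. *)
move: H0 H1 Ac Bc Ac_linear Bc_linear Ac_dense Bc_dense AcBc.
case: K conj / K_real_or_complex => H0 H1 Ac Bc Ac_lin Bc_lin Ac_dense Bc_dense AcBc.
  apply: (sharp_core_eigenvalue (theta := idfun)) => //.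
  - by move=> a; rewrite real_normK ?num_real// expr2.
  - exact: real_has_infima.
  - exact: real_nat_unbounded.
apply: (sharp_core_eigenvalue (theta := Num.conj)) => //.
- by move=> a; rewrite normCK.
- exact: complex_has_infima.
- exact: complex_nat_unbounded.
Qed.
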